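(* For both the MH dynamics (with $q\ge2$) and the cyclic dynamics (with $q\ge3$), writing $\widetilde\sigma_\beta(t)=\sigma_\beta(e^{\Gamma\beta}t)$, $$\lim_{\beta\to\infty}\ \max_{\mathbf a\in\mathcal S}\ \mathbb E_{\mathbf a}\Big[\int_0^T\mathbf 1\{\widetilde\sigma_\beta(u)\notin\mathcal S\}\,du\Big]=0\qquad\text{for all }T>0 .$$
   Context: Fix integers $K,L$ with $11\le K\le L$ and an integer $q\ge2$. Let $\Lambda=\mathbb T_K\times\mathbb T_L$ with $\mathbb T_n=\mathbb Z/n\mathbb Z$; $x\sim y$ means nearest neighbors. Let $S=\{1,\dots,q\}$, $\mathcal X=S^\Lambda$, $$H(\sigma)=\sum_{\{x,y\}\subset\Lambda,\ x\sim y}\mathbf 1\{\sigma(x)\ne\sigma(y)\}.$$ For $a\in S$, $\mathbf a\in\mathcal X$ is the configuration with all spins equal to $a$; $\mathcal S=\{\mathbf 1,\dots,\mathbf q\}$. For $x\in\Lambda$, $a\in S$, $\sigma^{x,a}$ is the configuration obtained from $\sigma$ by updating the spin at $x$ to $a$; $\tau_x\sigma$ is obtained from $\sigma$ by replacing $\sigma(x)$ with $\sigma(x)+1$ (convention $q+1=1$). For each $\beta>0$, $\sigma_\beta(\cdot)$ is one of the following continuous-time Markov chains on $\mathcal X$. MH dynamics: jump rates $r_\beta(\sigma,\zeta)=e^{-\beta\max\{H(\zeta)-H(\sigma),0\}}$ if $\zeta=\sigma^{x,a}\ne\sigma$ for some $x\in\Lambda,a\in S$, and $0$ otherwise. Cyclic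 dynamics ($q\ge3$): jump rates $r_\beta(\sigma,\zeta)=\exp\{-\beta[\max_{a\in S}H(\sigma^{x,a})-H(\sigma)]\}$ if $\zeta=\tau_x\sigma$ for some $x\in\Lambda$, and $0$ otherwise. $\Gamma=2K+2$ for the MH dynamics and $\Gamma=2K+4$ for the cyclic dynamics. $\mathbb E_\sigma$ is the expectation for the process started at $\sigma$. *)

(* Defs.v *)
From HB Require Import structures.
From mathcomp Require Import all_boot all_order all_algebra.
From mathcomp Require Import all_classical all_reals all_analysis.

Set Implicit Arguments.
Unset Strict Implicit.
Unset Printing Implicit Defensive.

Import Order.TTheory GRing.Theory Num.Theory.
Import numFieldNormedType.Exports.

(* ['Z_n] is Z/nZ only for [n >= 2]; the side lengths used are at least 11. *)
Notation torus K L := ('Z_K * 'Z_L)%type.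

(* The spin [a] of {1, ..., q} is the ordinal of value [a - 1]. *)
Notation config q K L := {ffun torus K L -> 'I_q}.

Section Potts.
Variables (q K L : nat).
Local Notation torus := (torus K L).
Local Notation config := (config q K L).

Definition torus_adj : rel torus := fun x y =>
  ((x.1 == y.1) && ((y.2 == x.2 + 1)%R || (x.2 == y.2 + 1)%R)) ||
  ((x.2 == y.2) && ((y.1 == x.1 + 1)%R || (x.1 == y.1 + 1)%R)).

Definition torus_edges : {set {set torus}} :=
  [set [set u.1; u.2] | u : torus * torus & torus_adj u.1 u.2]%SET.

Definition hamiltonian (s : config) : nat :=
  \sum_(e in torus_edges) [exists x in e, exists y in e, s x != s y].

Definition ground_states : {set config} :=
  [set [ffun=> a] | a : 'I_q]%SET.

Definition update (s : config) (x : torus) (a : 'I_q) : config :=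
  [ffun y => if y == x then a else s y].

Definition rotate (s : config) (x : torus) : config :=
  update s x (ordS (s x)).

Variant dynamics := Metropolis | Cyclic.

Definition min_spins (D : dynamics) : nat :=
  match D with Metropolis => 2 | Cyclic => 3 end.

Definition barrier (D : dynamics) : nat :=
  match D with Metropolis => 2 * K + 2 | Cyclic => 2 * K + 4 end.

Local Open Scope ring_scope.

Definition MH_rate (R : realType) (beta : R) (s z : config) : R :=
  if (z != s) && [exists x, exists a, z == update s x a]
  then expR (- (beta * Num.max ((hamiltonian z)%:R - (hamiltonian s)%:R) 0))
  else 0.

(* For [q >= 2] there is at most one [x] with [z = rotate s x]. *)
Definition cyclic_rate (R : realType) (beta : R) (s z : config) : R :=
  if [pick x | z == rotate s x] is Some x
  then expR (- (beta * ((\max_(a < q) hamiltonian (update s x a))%:R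
                        - (hamiltonian s)%:R)))
  else 0.

Definition jump_rate (D : dynamics) : forall R : realType,
    R -> config -> config -> R :=
  match D with Metropolis => MH_rate | Cyclic => cyclic_rate end.

End Potts.

Section MarkovChain.
Local Open Scope ring_scope.
Local Open Scope classical_set_scope.
Context {R : realType} {E : finType}.

Definition generator_matrix (r : E -> E -> R) (x y : E) : R :=
  if x == y then - \sum_(z | z != x) r x z else r x y.

Record transition_semigroup (r : E -> E -> R) (p : R -> E -> E -> R) : Prop := {
  semigroup_ge0 : forall (t : R) x y, 0 <= t -> 0 <= p t x y;
  semigroup_sum1 : forall (t : R) x, 0 <= t -> \sum_y p t x y = 1;
  semigroup0 : forall x y, p 0 x y = (x == y)%:R;
  semigroupD : forall (s t : R) x y, 0 <= s -> 0 <= t ->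
    p (s + t) x y = \sum_z p s x z * p t z y;
  semigroup_derive0 : forall x y,
    (p h x y - (x == y)%:R) / h @[h --> 0^'+] --> generator_matrix r x y }.

(* [chain_fdd] encodes both the Markov property and the initial law [X_0 = x0].
   Only times [t >= 0] matter; the values of [X] at negative times are junk. *)
Record markov_chain (r : E -> E -> R) (x0 : E)
    (d : measure_display) (Omega : measurableType d)
    (P : probability Omega R) (X : R -> Omega -> E) : Prop := {
  chain_measurable : forall (t : R) y, 0 <= t -> measurable [set w | X t w = y];
  chain_right_continuous : forall w (t : R), 0 <= t ->
    \forall u \near t^'+, X u w = X t w;
  chain_fdd : exists2 p, transition_semigroup r p &
    forall (n : nat) (t : nat -> R) (y : nat -> E),
      t 0%N = 0 -> (forall i, (i < n)%N -> t i <= t i.+1) ->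
      P [set w | forall i, (i <= n)%N -> X (t i) w = y i] =
      ((y 0%N == x0)%:R *
       \prod_(i < n) p (t i.+1 - t i) (y i) (y i.+1))%:E }.

End MarkovChain.

(* Main.v *)
Require Import Defs.
From mathcomp Require Import all_boot all_order all_algebra.
From mathcomp Require Import all_classical all_reals all_analysis.
From mathcomp Require Import measurable_realfun.

Set Implicit Arguments.
Unset Strict Implicit.
Unset Printing Implicit Defensive.

Import Order.TTheory GRing.Theory Num.Theory.
Import numFieldNormedType.Exports.
Local Open Scope classical_set_scope.
Local Open Scope ring_scope.

(** The Gibbs weight exp (- beta * H) is invariant for both dynamics, and this
    alone gives the theorem. For the Metropolis rates it is detailed balance
    ([MH_rate_reversible]). The cyclic rates are not reversible, but the Gibbs
    flow through a rotation of the spin at x is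
    exp (- beta * max_a H (update s x a)), which is the same for all q
    rotations along the cycle of spin values at x; hence every cycle brings as
    much mass into a configuration as it takes out ([gibbs_cyclic_rate],
    [cyclic_gibbs_balanced]).

    Let mu be the Gibbs weight and p_t the transition semigroup. Invariance
    says that mu p_t = mu ([invariant_semigroup]), and all the terms of
    sum_x mu(x) p_t(x, y) = mu(y) are nonnegative. Keeping only the term x = a
    for a ground state a, where H (a) = 0 and mu(a) = 1, yields
    p_t(a, y) <= mu(y) = exp (- beta * H y). Outside the ground states H >= 1,
    because the torus is connected ([hamiltonian_gt0]). So the probability of
    not being in a ground state is at most #|config| * exp (- beta), at every
    time and therefore on every time scale ([markov_chain_set_le]).

    By Tonelli's theorem the expected time spent outside the ground states
    before T is at most T * #|config| * exp (- beta), which tends to 0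
    ([expected_occupation_le]). Joint measurability of the process in time and
    randomness comes from the right-continuity of the paths
    ([measurable_occupation]). *)

(** * Invariant measures of a finite Markov chain *)

Definition invariant {R : realType} {E : finType} (r : E -> E -> R)
    (mu : E -> R) :=
  forall y, \sum_x mu x * generator_matrix r x y = 0.

(** The diagonal entry of the generator carries the total outflow from y. *)
Lemma balanced_invariant (R : realType) (E : finType) (r : E -> E -> R)
    (mu : E -> R) :
    (forall y,
      \sum_(z | z != y) mu y * r y z = \sum_(z | z != y) mu z * r z y) ->
  invariant r mu.
Proof.
move=> bal y; rewrite (bigD1 y) //= /generator_matrix eqxx mulrN mulr_sumr bal.
apply/eqP; rewrite addrC subr_eq0; apply/eqP; apply: eq_bigr => x /negPf xy.
by rewrite xy.
Qed.

Definition l1_defect {R : realType} {E : finType} (mu : E -> R)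
    (p : R -> E -> E -> R) (t : R) : R :=
  \sum_y `|\sum_x mu x * p t x y - mu y|.

(** mu p_(s+t) - mu = (mu p_s - mu) p_t + (mu p_t - mu), and the stochastic
    matrix p_t does not increase the l1 norm. *)
Lemma l1_defect_subadditive (R : realType) (E : finType) (r : E -> E -> R)
    (mu : E -> R) (p : R -> E -> E -> R) (s t : R) :
    transition_semigroup r p -> 0 <= s -> 0 <= t ->
  l1_defect mu p (s + t) <= l1_defect mu p s + l1_defect mu p t.
Proof.
move=> pP s0 t0.
have splitE y : \sum_x mu x * p (s + t) x y - mu y =
    \sum_z (\sum_x mu x * p s x z - mu z) * p t z y
    + (\sum_x mu x * p t x y - mu y).
  under [X in _ = X + _]eq_bigr do rewrite mulrBl mulr_suml.
  rewrite sumrB addrA subrK exchange_big; congr (_ - _).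
  apply: eq_bigr => x _; rewrite (semigroupD pP)// mulr_sumr.
  by apply: eq_bigr => z _; rewrite mulrA.
rewrite /l1_defect; under eq_bigr do rewrite splitE.
apply: (@le_trans _ _ (\sum_y (\sum_z `|\sum_x mu x * p s x z - mu z| * p t z y
    + `|\sum_x mu x * p t x y - mu y|))).
  apply: ler_sum => y _; apply: (le_trans (ler_normD _ _)); rewrite lerD2r.
  apply: (le_trans (ler_norm_sum _ _ _)); apply: ler_sum => z _.
  by rewrite normrM (ger0_norm (semigroup_ge0 pP _ _ _)).
rewrite big_split /= lerD2r exchange_big /=; apply: ler_sum => z _.
by rewrite -mulr_sumr (semigroup_sum1 pP)// mulr1.
Qed.

(** The derivative at 0 of mu p_h is mu times the generator, which vanishes. *)
Lemma l1_defect_small (R : realType) (E : finType) (r : E -> E -> R)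
    (mu : E -> R) (p : R -> E -> E -> R) :
    transition_semigroup r p -> invariant r mu ->
  l1_defect mu p h / h @[h --> 0^'+] --> 0.
Proof.
move=> pP muP.
have sum0 : \sum_(y : E) `|\sum_x mu x * generator_matrix r x y| = 0.
  by rewrite big1// => y _; rewrite muP normr0.
have : \sum_y `|\sum_x mu x * ((p h x y - (x == y)%:R) / h)| @[h --> 0^'+] -->
    \sum_(y : E) `|\sum_x mu x * generator_matrix r x y|.
  apply: cvg_big => [|y _]; first exact: add_continuous.
  apply: cvg_norm; apply: cvg_big => [|x _]; first exact: add_continuous.
  by apply: cvgM; [exact: cvg_cst|exact: (semigroup_derive0 pP)].
rewrite sum0 => lim_ratio.
apply: cvg_trans lim_ratio; apply: near_eq_cvg; near=> h.
have h0 : 0 < h by near: h; apply: nbhs_right_gt.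
rewrite /l1_defect mulr_suml; apply: eq_bigr => y _.
transitivity `|(\sum_x mu x * p h x y - mu y) / h|; last first.
  by rewrite normf_div (gtr0_norm h0).
congr `|_|; under eq_bigr do rewrite mulrA mulrBr.
rewrite -mulr_suml sumrB; congr ((_ - _) / _).
rewrite (bigD1 y)//= eqxx mulr1 big1 ?addr0// => x /negPf ->.
by rewrite mulr0.
Unshelve. all: by end_near. Qed.

(** Cutting [0, t] into n steps bounds the defect at time t by n times the
    defect at time t/n, which is n o(t/n) = o(1). Thus the derivative of the
    semigroup is only used at time 0. *)
Lemma invariant_semigroup (R : realType) (E : finType) (r : E -> E -> R)
    (mu : E -> R) (p : R -> E -> E -> R) (t : R) (y : E) :
    transition_semigroup r p -> invariant r mu -> 0 <= t ->
  \sum_x mu x * p t x y = mu y.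
Proof.
move=> pP muP; rewrite le_eqVlt => /predU1P[<-|t0].
  rewrite (bigD1 y)//= (semigroup0 pP) eqxx mulr1 big1 ?addr0// => x /negPf xy.
  by rewrite (semigroup0 pP) xy mulr0.
suff l1_defect0 : l1_defect mu p t <= 0.
  apply/eqP; rewrite -subr_eq0 -normr_le0; apply: le_trans l1_defect0.
  by rewrite /l1_defect [leRHS](bigD1 y)//= lerDl sumr_ge0.
have step n h : 0 <= h -> l1_defect mu p (n.+1%:R * h) <= n.+1%:R * l1_defect mu p h.
  move=> h0; elim: n => [|n IH]; first by rewrite !mul1r.
  rewrite -addn1 natrD !mulrDl !mul1r.
  apply: le_trans (l1_defect_subadditive _ pP _ _) _ => //.
    by rewrite mulr_ge0.
  by rewrite lerD2r.
have h0 n : 0 < t / n.+1%:R by rewrite divr_gt0.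
have hn : t / n.+1%:R @[n --> \oo] --> 0.
  by rewrite -(mulr0 t); apply: cvgM; [exact: cvg_cst|exact: cvg_harmonic].
have /cvg_at_rightP /(_ _ (conj h0 hn)) small := l1_defect_small pP muP.
have {}small : t * (l1_defect mu p (t / n.+1%:R) / (t / n.+1%:R)) @[n --> \oo] --> 0.
  by rewrite -(mulr0 t); apply: cvgM; [exact: cvg_cst|exact: small].
apply: (cvgr_to_ge small); near=> n.
have := step n _ (ltW (h0 n)); rewrite mulrCA divff// mulr1 => /le_trans; apply.
by rewrite mulrCA invf_div (mulrCA t) divff ?gt_eqF// mulr1 mulrC.
Unshelve. all: by end_near. Qed.

(** * Occupation times of right-continuous processes *)

(** The first point strictly after u of the mesh of step 1 / (n + 1): it has to
    be strict, because right-continuity speaks of punctured right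
    neighbourhoods. *)
Definition next_mesh (R : realType) (n : nat) (u : R) : R :=
  (Num.trunc (n.+1%:R * u)).+1%:R / n.+1%:R.

Lemma next_mesh_gt (R : realType) (n : nat) (u : R) : u < next_mesh n u.
Proof. by rewrite ltr_pdivlMr// mulrC truncnS_gt. Qed.

Lemma next_mesh_cvg (R : realType) (u : R) : 0 <= u ->
  next_mesh n u @[n --> \oo] --> u.
Proof.
move=> u0.
have hi : u + n.+1%:R^-1 @[n --> \oo] --> u.
  by rewrite -[X in _ --> X]addr0; apply: cvgD; [exact: cvg_cst|exact: cvg_harmonic].
apply: squeeze_cvgr (cvg_cst u) hi; near=> n.
rewrite (ltW (next_mesh_gt _ _))/= ler_pdivrMr// mulrDl mulVf// -natr1 lerD2r.
by rewrite mulrC truncn_le// mulr_ge0.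
Unshelve. all: by end_near. Qed.

Lemma next_mesh_near (R : realType) (u : R) (Q : R -> Prop) : 0 <= u ->
  (\forall v \near u^'+, Q v) -> \forall n \near \oo, Q (next_mesh n u).
Proof.
move=> u0 [e /= e0 Qe]; near=> n; apply: Qe; last exact: next_mesh_gt.
near: n; have /cvgrPdist_lt := next_mesh_cvg u0; exact.
Unshelve. all: by end_near. Qed.

Section occupation.
Context {R : realType} {E : finType} {d : measure_display}
  {Omega : measurableType d}.
Variables (X : R -> Omega -> E) (A : set E).
Hypothesis X_meas : forall (t : R) y, 0 <= t -> measurable [set w | X t w = y].
Hypothesis X_rc : forall w (t : R), 0 <= t -> \forall u \near t^'+, X u w = X t w.

Lemma measurable_state (t : R) : 0 <= t -> measurable [set w | A (X t w)].
Proof.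
move=> t0.
have -> : [set w | A (X t w)] = \bigcup_(y in A) [set w | X t w = y].
  by apply/seteqP; split=> w /= => [Aw|[y Ay ->]//]; exists (X t w).
apply: fin_bigcup_measurable => [|y _]; first exact: finite_finset.
exact: X_meas.
Qed.

(** Between two points of the mesh only the state at one fixed time matters,
    so the set is a countable union of measurable rectangles. *)
Lemma measurable_mesh_occupation (n : nat) : measurable
  [set uw : R * Omega | 0 <= uw.1 /\ A (X (next_mesh n uw.1) uw.2)].
Proof.
have -> : [set uw : R * Omega | 0 <= uw.1 /\ A (X (next_mesh n uw.1) uw.2)] =
    \bigcup_k ([set` `[k%:R / n.+1%:R, k.+1%:R / n.+1%:R[] `*`
               [set w | A (X (k.+1%:R / n.+1%:R) w)]).
  have mesh k (u : R) : u \in `[k%:R / n.+1%:R, k.+1%:R / n.+1%:R[ ->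
      0 <= u /\ Num.trunc (n.+1%:R * u) = k.
    rewrite in_itv/= ler_pdivrMr// ltr_pdivlMr// => ku.
    split; last by apply: truncn_def; rewrite mulrC.
    have /andP[+ _] := ku; rewrite -(pmulr_lge0 _ (ltr0Sn R n)).
    by rewrite mulrC; apply: le_trans.
  apply/seteqP; split=> [[u w] /= [u0 Au]|[u w] [k _ [/= /mesh [u0 uk] Aw]]].
    exists (Num.trunc (n.+1%:R * u)) => //; split => //=.
    rewrite in_itv/= ler_pdivrMr// ltr_pdivlMr// mulrC.
    by apply: truncn_itv; rewrite mulr_ge0.
  by split => //; rewrite /next_mesh uk.
apply: bigcup_measurable => k _; apply: measurableX; first exact: measurable_itv.
by apply: measurable_state; rewrite divr_ge0.
Qed.

(** E being discrete, right-continuity makes X (next_mesh n u) equal to X u for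
    n large: the set is the lower limit of its discretizations. *)
Lemma measurable_occupation :
  measurable [set uw : R * Omega | 0 <= uw.1 /\ A (X uw.1 uw.2)].
Proof.
have -> : [set uw : R * Omega | 0 <= uw.1 /\ A (X uw.1 uw.2)] =
    \bigcup_m \bigcap_(n >= m)
      [set uw : R * Omega | 0 <= uw.1 /\ A (X (next_mesh n uw.1) uw.2)].
  apply/seteqP; split=> [[u w] /= [u0 Au]|[u w] [m _ mE]].
    have [m _ mE] := next_mesh_near u0 (X_rc w u0).
    exists m => // n mn /=; split => //.
    by rewrite (mE n mn).
  have /= [u0 _] := mE m (leqnn m); split => //=.
  have [k _ kE] := next_mesh_near u0 (X_rc w u0).
  have /= [_] := mE (maxn m k) (leq_maxl _ _).
  by rewrite (kE _ (leq_maxr _ _)).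
apply: bigcup_measurable => m _; apply: bigcap_measurable => [|n _].
  by exists m => /=.
exact: measurable_mesh_occupation.
Qed.

(** Tonelli's theorem, applied to the set of the pairs (u, w) with X (c u) w in
    A: the time sections give the occupation time, the sections in w give the
    probabilities bounded by b. The lower bound is kept because the maximum of
    these expectations is later squeezed. *)
Lemma expected_occupation_le (P : probability Omega R) (c T b : R) :
    0 <= c -> 0 < T ->
    (forall t, 0 <= t -> (P [set w | A (X t w)] <= b%:E)%E) ->
  (0 <= 'E_P[fun w => (\int[lebesgue_measure]_(u in `[0, T])
                         \1_A (X (c * u) w))%R]
     <= (T * b)%:E)%E.
Proof.
move=> c0 T0 Pb.
pose B := [set uw : R * Omega | uw.1 \in `[0, T] /\ A (X (c * uw.1) uw.2)].
have mB : measurable B.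
  have -> : B = ([set` `[0, T]] `*` setT) `&`
     (fun uw : R * Omega => (c * uw.1, uw.2)) @^-1`
       [set uw : R * Omega | 0 <= uw.1 /\ A (X uw.1 uw.2)].
    apply/seteqP; split=> [[u w] /= [uT Au]|[u w] /= [[uT _] [_ Au]]] //.
    split => //; split => //; rewrite mulr_ge0//.
    by move: uT; rewrite in_itv/= => /andP[].
  apply: measurableI; first by apply: measurableX => //; exact: measurable_itv.
  rewrite -[X in measurable X]setTI.
  apply: measurable_fun_pair => //; last exact: measurable_occupation.
  apply: measurableT_comp measurable_fst; exact: mulrl_measurable.
have mBw w : measurable (ysection B w) by exact: measurable_ysection.
have inner w : (\int[lebesgue_measure]_(u in `[0%R, T]) (\1_A (X (c * u)%R w))%:E)%E
   = lebesgue_measure (ysection B w).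
  rewrite -[in RHS](@setIidl _ (ysection B w) `[0%R, T]) => [|u /=]; last first.
    by rewrite ysectionE => -[].
  rewrite -integral_indic//; last exact: mBw.
  apply: eq_integral => u uT; congr EFin.
  rewrite !indicE mem_ysection; congr ((nat_of_bool _)%:R).
  by rewrite inE in uT; apply/idP/idP => /[!inE] => [Au|[]].
have itvT : lebesgue_measure (`[0, T]%classic : set R) = T%:E.
  by rewrite lebesgue_measure_itv /= lte_fin T0 sube0.
have le_T w : (lebesgue_measure (ysection B w) <= T%:E)%E.
  rewrite -itvT; apply: le_measure; rewrite ?inE//; first exact: mBw.
  by move=> u; rewrite ysectionE => -[].
have intE w : (\int[lebesgue_measure]_(u in `[0, T]) \1_A (X (c * u) w))%:E =
    lebesgue_measure (ysection B w).
  rewrite /Rintegral inner fineK// ge0_fin_numE ?measure_ge0//.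
  exact: le_lt_trans (le_T w) (ltry _).
apply/andP; split; rewrite unlock.
  by apply: integral_ge0 => w _; rewrite intE.
under eq_integral do rewrite intE.
have := indic_fubini_tonelli lebesgue_measure P mB.
rewrite indic_fubini_tonelli_FE// indic_fubini_tonelli_GE// => <-.
have xB u : (xsection B u =
    if u \in `[0%R, T] then [set w | A (X (c * u) w)] else set0)%R.
  rewrite xsectionE; case: ifP => uT; apply/seteqP; split => w //=.
    by case.
  by case; rewrite uT.
apply: (@le_trans _ _ (\int[lebesgue_measure]_(u in `[0%R, T]) cst b%:E u)%E).
  rewrite [leRHS]integral_mkcond; apply: ge0_le_integral => //.
  - exact: measurable_fun_xsection.
  - by apply/(measurable_restrictT _ _).1 => //; exact: measurable_cst.
  - move=> u _ /=; rewrite patchE mem_setE xB; case: ifP => uT.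
      apply: Pb; rewrite mulr_ge0//.
      by move: uT; rewrite in_itv/= => /andP[].
    by rewrite measure0.
rewrite integral_cst; last exact: measurable_itv.
by rewrite [X in (_ * X)%E]itvT -EFinM mulrC.
Qed.

End occupation.

(** * From an invariant measure to the law of the chain *)

(** Boole's inequality over a finite type. *)
Lemma measure_le_sum (d : measure_display) (T : measurableType d)
    (R : realType) (mu : {measure set T -> \bar R}) (I : finType)
    (Q : pred I) (B : set T) (F : I -> set T) :
    measurable B -> (forall i, measurable (F i)) ->
    B `<=` \bigcup_(i in [set` Q]) F i ->
  (mu B <= \sum_(i | Q i) mu (F i))%E.
Proof.
move=> mB mF BF; rewrite (bigfs _ (index_enum_uniq I)) => [|i _]; last first.
  by rewrite mem_index_enum.
exact: content_sub_fsum.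
Qed.

Section chain.
Context {R : realType} {E : finType} {d : measure_display}
  {Omega : measurableType d}.
Variables (r : E -> E -> R) (x0 : E) (P : probability Omega R)
  (X : R -> Omega -> E).
Hypothesis chain : markov_chain r x0 P X.

(** The finite-dimensional laws are given for paths whose value at time 0 is
    prescribed; summing over that value recovers the law at time t. *)
Lemma markov_chain_state_le (t : R) (y : E) : 0 <= t ->
  exists2 p, transition_semigroup r p &
    (P [set w | X t w = y] <= (p t x0 y)%:E)%E.
Proof.
move=> t0; have [p pP fdd] := chain_fdd chain; exists p => //.
pose F z := [set w | X 0 w = z] `&` [set w | X t w = y].
have mF z : measurable (F z) by apply: measurableI; apply: (chain_measurable chain).
have FE z : P (F z) = ((z == x0)%:R * p t z y)%:E.
  have := fdd 1%N (fun i => if i == 0%N then 0 else t)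
              (fun i => if i == 0%N then z else y) erefl.
  rewrite big_ord1/= subr0 => <-; last by case.
  congr (P _); apply/seteqP; split=> [w [Xz Xy] [|[|]]//|w Xw].
  by split; [exact: (Xw 0%N)|exact: (Xw 1%N)].
have cover : [set w | X t w = y] `<=` \bigcup_(z in [set` predT]) F z.
  by move=> w Xw; exists (X 0 w).
apply: le_trans (measure_le_sum P (chain_measurable chain y t0) mF cover) _.
rewrite (eq_bigr _ (fun z _ => FE z)) sumEFin lee_fin.
rewrite (bigD1 x0)//= eqxx mul1r big1 ?addr0// => z /negPf ->.
by rewrite mul0r.
Qed.

(** Dropping all the terms but x0 from mu(y) = sum_x mu(x) p_t(x, y) leaves
    p_t(x0, y) <= mu(y) / mu(x0). *)
Lemma markov_chain_set_le (mu : E -> R) (A : set E) (b t : R) :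
    invariant r mu -> (forall x, 0 <= mu x) -> 0 < mu x0 ->
    (forall y, A y -> mu y <= b * mu x0) -> 0 <= b -> 0 <= t ->
  (P [set w | A (X t w)] <= (#|E|%:R * b)%:E)%E.
Proof.
move=> muP mu0 mux0 Ab b0 t0.
have mX y : measurable [set w | X t w = y] by exact: (chain_measurable chain).
have cover : [set w | A (X t w)] `<=` \bigcup_(y in [set` mem A]) [set w | X t w = y].
  by move=> w Aw; exists (X t w) => //=; exact: mem_set.
have mA : measurable [set w | A (X t w)].
  exact: (measurable_state A (chain_measurable chain) t0).
apply: le_trans (measure_le_sum P mA mX cover) _.
apply: (@le_trans _ _ (\sum_(y : E | y \in A) b%:E)%E); last first.
  rewrite sumEFin lee_fin sumr_const -[leLHS]mulr_natl ler_wpM2r// ler_nat.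
  exact: max_card.
apply: lee_sum => y /set_mem Ay.
have [p pP /le_trans] := markov_chain_state_le y t0; apply; rewrite lee_fin.
rewrite -(ler_pM2r mux0); apply: le_trans (Ab y Ay).
rewrite -(invariant_semigroup y pP muP t0) mulrC (bigD1 x0)//= lerDl.
by apply: sumr_ge0 => x _; rewrite mulr_ge0// (semigroup_ge0 pP).
Qed.

End chain.

(** * Energy of the Potts model *)

Lemma Z_shift_invariant (n : nat) (T : Type) (f : 'Z_n -> T) :
  (forall i, f (i + 1) = f i) -> forall i, f i = f 0.
Proof.
move=> fS i; rewrite -[i]natr_Zp; elim: (val i) => [//|m IH].
by rewrite -addn1 natrD fS.
Qed.

Lemma hamiltonian_ground (q K L : nat) (s : config q K L) :
  s \in ground_states q K L -> hamiltonian s = 0%N.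
Proof.
move=> /imsetP[a _ ->]; rewrite /hamiltonian big1// => e _.
apply/eqP; rewrite eqb0; apply/exists_inPn => x _; apply/exists_inPn => y _.
by rewrite !ffunE eqxx.
Qed.

(** At energy 0 all neighbours agree, so the configuration is invariant under
    the unit translations in both directions, which act transitively. *)
Lemma hamiltonian_gt0 (q K L : nat) (s : config q K L) :
  s \notin ground_states q K L -> (0 < hamiltonian s)%N.
Proof.
rewrite lt0n; apply: contraNN.
rewrite /hamiltonian sum_nat_eq0 => /forall_inP H0.
have eq_adj x y : torus_adj x y -> s x = s y.
  move=> xy; have exy : [set x; y]%SET \in torus_edges K L.
    by apply/imsetP; exists (x, y); rewrite ?inE.
  have := H0 _ exy; rewrite eqb0 => /exists_inPn /(_ x (set21 _ _)).
  by move=> /exists_inPn /(_ y (set22 _ _)); rewrite negbK => /eqP.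
apply/imsetP; exists (s (0, 0)) => //; apply/ffunP => -[i j]; rewrite ffunE.
rewrite (Z_shift_invariant (f := fun k => s (k, j))) => [|k].
  rewrite (Z_shift_invariant (f := fun k => s (0, k)))// => k.
  by apply: eq_adj; rewrite /torus_adj /= !eqxx orbT.
by apply: eq_adj; rewrite /torus_adj /= !eqxx !orbT.
Qed.

(** * Invariance of the Gibbs weight *)

(** Not normalized, so that its value at the ground states is 1. *)
Definition gibbs {R : realType} {q K L : nat} (beta : R)
    (s : config q K L) : R :=
  expR (- (beta * (hamiltonian s)%:R)).

(** Both sides are exp (- beta * max (H s) (H z)) if s and z differ at exactly
    one site. *)
Lemma MH_rate_reversible (R : realType) (q K L : nat) (beta : R)
    (s z : config q K L) :
  gibbs beta s * MH_rate beta s z = gibbs beta z * MH_rate beta z s.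
Proof.
have reach (u v : config q K L) :
    [exists x, exists a, v == update u x a] ->
    [exists x, exists a, u == update v x a].
  move=> /existsP[x /existsP[a /eqP ->]]; apply/existsP; exists x.
  apply/existsP; exists (u x); apply/eqP/ffunP => y; rewrite !ffunE.
  by case: eqP => [->|].
rewrite /MH_rate eq_sym.
have -> : [exists x, exists a, z == update s x a] =
    [exists x, exists a, s == update z x a] by apply/idP/idP; apply: reach.
case: ifP => _; last by rewrite !mulr0.
rewrite /gibbs -!expRD -!opprD -!mulrDr; congr (expR (- (_ * _))).
have maxE (a b : R) : a + Num.max (b - a) 0 = Num.max a b.
  by rewrite addr_maxr addrC subrK addr0 maxC.
by rewrite !maxE maxC.
Qed.

Lemma MH_gibbs_balanced (R : realType) (q K L : nat) (beta : R)
    (y : config q K L) :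
  \sum_(z | z != y) gibbs beta y * MH_rate beta y z =
  \sum_(z | z != y) gibbs beta z * MH_rate beta z y.
Proof. by apply: eq_bigr => z _; apply: MH_rate_reversible. Qed.

Lemma rotate_neq (q K L : nat) (s : config q K L) x :
  (1 < q)%N -> rotate s x x != s x.
Proof.
move=> q1; rewrite ffunE eqxx -val_eqE /=.
have := ltn_ord (s x); rewrite leq_eqVlt => /predU1P[sq|sq].
  by rewrite sq modnn; apply/eqP=> s0; rewrite -sq -s0 ltnn in q1.
by rewrite modn_small// neq_ltn ltnSn orbT.
Qed.

Lemma update_rotate (q K L : nat) (s : config q K L) x a :
  update (rotate s x) x a = update s x a.
Proof. by apply/ffunP => y; rewrite !ffunE; case: eqP. Qed.

Lemma rotate_inj (q K L : nat) (x : torus K L) :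
  injective (fun s : config q K L => rotate s x).
Proof.
move=> s z /ffunP sz; apply/ffunP => y; have := sz y; rewrite !ffunE.
by case: eqP => [->|//]; apply: (can_inj (@ordSK q)).
Qed.

(** The Gibbs flow through each rotation of the spin at x; it does not depend on
    the spin of s at x. *)
Definition cycle_flow {R : realType} {q K L : nat} (beta : R)
    (s : config q K L) (x : torus K L) : R :=
  expR (- (beta * (\max_(a < q) hamiltonian (update s x a))%:R)).

(** Replaces the choice of the rotated site by a sum over sites, which can be
    exchanged with sums over configurations. The sum has at most one nonzero
    term, since for q >= 2 a rotation moves the spin and so determines its
    site. *)
Lemma gibbs_cyclic_rate (R : realType) (q K L : nat) (beta : R)
    (s z : config q K L) : (1 < q)%N ->
  gibbs beta s * cyclic_rate beta s z =
  \sum_x (z == rotate s x)%:R * cycle_flow beta s x.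
Proof.
move=> q1; rewrite /cyclic_rate; case: pickP => [x /eqP zx|nz]; last first.
  by rewrite mulr0 big1// => x _; rewrite nz mul0r.
rewrite (bigD1 x)//= zx eqxx mul1r -[LHS]addr0; congr (_ + _).
  rewrite /gibbs /cycle_flow -expRD -opprD -mulrDr; congr (expR (- (_ * _))).
  by rewrite addrC subrK.
rewrite big1// => y yx; case: (_ =P rotate s y) => [|_]; last by rewrite mul0r.
move=> /ffunP /(_ y); rewrite {1}/rotate {1}/update ffunE (negPf yx) => /eqP.
by rewrite eq_sym (negPf (rotate_neq _ _ q1)).
Qed.

(** For each site x, the outflow of y is the flow on the edge of the x-cycle that
    leaves y, and the inflow is the flow on the edge that enters it; rotation
    being injective, there is exactly one of each, and the two flows agree. *)
Lemma cyclic_gibbs_balanced (R : realType) (q K L : nat) (beta : R)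
    (y : config q K L) : (1 < q)%N ->
  \sum_(z | z != y) gibbs beta y * cyclic_rate beta y z =
  \sum_(z | z != y) gibbs beta z * cyclic_rate beta z y.
Proof.
move=> q1.
have noloop : gibbs beta y * cyclic_rate beta y y = 0.
  rewrite gibbs_cyclic_rate// big1// => x _; case: (y =P rotate y x) => [|_].
    by move=> /ffunP /(_ x) /eqP; rewrite eq_sym (negPf (rotate_neq _ _ q1)).
  by rewrite mul0r.
suff : \sum_z gibbs beta y * cyclic_rate beta y z =
       \sum_z gibbs beta z * cyclic_rate beta z y.
  by rewrite (bigD1 y)//= [RHS](bigD1 y)//= noloop !add0r.
under eq_bigr do rewrite gibbs_cyclic_rate//.
under [RHS]eq_bigr do rewrite gibbs_cyclic_rate//.
rewrite exchange_big [RHS]exchange_big /=; apply: eq_bigr => x _.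
transitivity (cycle_flow beta y x).
  rewrite (bigD1 (rotate y x))//= eqxx mul1r big1 ?addr0// => z /negPf ->.
  by rewrite mul0r.
(* Reindexing by the rotation turns the sum over predecessors of y into one
   supported at y, because the flow is constant along the cycle. *)
transitivity (\sum_z (y == z)%:R * cycle_flow beta z x).
  rewrite (bigD1 y)//= eqxx mul1r big1 ?addr0// => z.
  by rewrite eq_sym => /negPf ->; rewrite mul0r.
rewrite (reindex_inj (@rotate_inj q K L x)) /=.
apply: eq_bigr => z _; congr (_ * expR (- (_ * _%:R))).
by apply: eq_bigr => a _; rewrite update_rotate.
Qed.

Lemma gibbs_invariant (R : realType) (q K L : nat) (D : dynamics) (beta : R) :
  (min_spins D <= q)%N ->
  invariant (@jump_rate q K L D R beta) (@gibbs R q K L beta).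
Proof.
move=> hq; apply: balanced_invariant => y; case: D hq => hq.
  exact: MH_gibbs_balanced.
by apply: cyclic_gibbs_balanced; apply: leq_trans hq.
Qed.

(** * Negligible time outside the ground states *)

Theorem theorem3p3 (R : realType) (q K L : nat)
    (hK : (11 <= K)%N) (hKL : (K <= L)%N)
    (D : dynamics) (hq : (min_spins D <= q)%N)
    (d : R -> measure_display)
    (Omega : forall beta : R, measurableType (d beta))
    (P : forall beta : R, config q K L -> probability (Omega beta) R)
    (sigma : forall beta : R, R -> Omega beta -> config q K L)
    (hsigma : forall (beta : R) (s : config q K L), 0 < beta ->
       markov_chain (jump_rate D beta) s (P beta s) (sigma beta))
    (T : R) (hT : 0 < T) :
  (\big[maxe/-oo%E]_(a in ground_states q K L)
     ('E_(P beta a)[fun w => (\int[lebesgue_measure]_(u in `[0, T])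
        \1_(~` [set` ground_states q K L])
          (sigma beta (expR ((barrier K D)%:R * beta) * u) w))%R])%E)
    @[beta --> +oo%R] --> 0%E.
Proof.
pose N : R := #|config q K L|%:R.
have bound (beta : R) (a : config q K L) : 0 < beta -> a \in ground_states q K L ->
    (0 <= 'E_(P beta a)[fun w => (\int[lebesgue_measure]_(u in `[0, T])
        \1_(~` [set` ground_states q K L])
          (sigma beta (expR ((barrier K D)%:R * beta) * u) w))%R]
       <= (T * (N * expR (- beta)))%:E)%E.
  move=> beta0 ground_a; have ch := hsigma beta a beta0.
  apply: expected_occupation_le.
  - exact: (chain_measurable ch).
  - exact: (chain_right_continuous ch).
  - exact: expR_ge0.
  - exact: hT.
  - move=> t t0; apply: (markov_chain_set_le ch (gibbs_invariant beta hq)) => //.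
    + by move=> s; exact: expR_ge0.
    + exact: expR_gt0.
    + move=> s /= /negP sNground; rewrite /gibbs (hamiltonian_ground ground_a).
      rewrite mulr0 oppr0 expR0 mulr1 ler_expR lerN2 -[leLHS]mulr1.
      by rewrite ler_pM2l// ler1n hamiltonian_gt0.
(* The maximum over an empty set of ground states would be -oo. *)
have q0 : (0 < q)%N by apply: leq_trans hq; case: (D).
pose a0 : config q K L := [ffun=> Ordinal q0].
have ground_a0 : a0 \in ground_states q K L by apply/imsetP; exists (Ordinal q0).
have to0 : (T * (N * expR (- beta)))%:E @[beta --> +oo] --> 0%E.
  apply: cvg_EFin; first by near=> beta.
  rewrite -(mulr0 T); apply: cvgM; first exact: cvg_cst.
  by rewrite -(mulr0 N); apply: cvgM; [exact: cvg_cst|exact: cvgr_expR].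
apply: squeeze_cvge (cvg_cst 0%E) to0.
near=> beta; have beta0 : 0 < beta by near: beta; exact: nbhs_pinfty_gt.
apply/andP; split.
  have /andP[/le_trans + _] := bound beta a0 beta0 ground_a0; apply.
  exact: le_bigmax_cond.
apply/bigmax_leP; split; first exact: leNye.
by move=> a ga; have /andP[] := bound beta a beta0 ga.
Unshelve. all: by end_near.
Qed.
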